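(* Let $\mathcal{T}(z)=\mathcal{R}(z)^*\mathcal{R}(z)$, where $\mathcal{R}(z)=(z\mathcal{I}-\mathcal{L})^{-1}$ is a bounded operator on a complex separable Hilbert space $\mathcal{H}$, put $\xi=\|\mathcal{T}(z)\|$, and let $u_1,\dots,u_{k+1}\in\mathcal{H}$, $\beta_{k+1}$ and the real symmetric tridiagonal matrix $H_k\in\mathbb{R}^{k\times k}$ be produced by $k$ steps of the perturbed Lanczos process described in the context, with error parameter $\zeta^{(k)}$ and machine epsilon $\epsilon_m$. Let the eigendecomposition of $H_k$ be $$H_kY^{(k)}=Y^{(k)}\,\mathrm{diag}(\mu_j^{(k)}),$$ where $Y^{(k)}$ is orthonormal with $(i,j)$th entry $y_{ij}^{(k)}$, and assume $\mu_1^{(k)}>\mu_2^{(k)}>\cdots>\mu_k^{(k)}$. If the $\mu_j^{(k)}$ are well separated, i.e. $$\min_{i\ne j}|\mu_j^{(k)}-\mu_i^{(k)}|\ge\sqrt{2}\,k^{5/2}\zeta^{(k)}\xi^{3/2}\epsilon_m,$$ then the distance between $\mu_j^{(k)}$ and the spectrum of $\mathcal{T}(z)$ is bounded as $$\mathrm{dist}\bigl(\mu_j^{(k)},\sigma(\mathcal{T}(z))\bigr)<\frac52\left(\beta_{k+1}|y_{kj}^{(k)}|+\sqrt{k}\,\zeta^{(k)}\xi^{3/2}\epsilon_m\right).$$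
   Context: $\mathcal{L}$ is a closed linear operator on $\mathcal{H}$, $z\in\mathbb{C}$ is in its resolvent set, and $\sigma(\cdot)$ denotes the spectrum; $\epsilon_m>0$ is the machine epsilon. Perturbed Lanczos process. Start from $u_1\in\mathcal{H}$ with $\|u_1\|=1$ (and $\beta_1u_0=0$). For $j=1,\dots,k$: - a vector $w_j\in\mathcal{H}$ is computed as an approximation to $\mathcal{T}(z)u_j$, with error $\|\mathcal{T}(z)u_j-w_j\|\le\zeta(u_j)\,\xi^{3/2}\epsilon_m\|u_j\|$ for some number $\zeta(u_j)>0$; - $p_j=w_j-\beta_ju_{j-1}$ for $j>1$, and $p_1=w_1$; - $\alpha_j=\mathrm{Re}\langle u_j,p_j\rangle$; - $q_j=p_j-\alpha_ju_j$, $\beta_{j+1}=\|q_j\|$ (assumed nonzero), $u_{j+1}=q_j/\beta_{j+1}$. The only error taken into account is that in $w_j$; all other operations are regarded as exact. $H_k$ is the real symmetric tridiagonal matrix with diagonal $\alpha_1,\dots,\alpha_k$ and off-diagonal entries $\beta_2,\dots,\beta_k$. The error parameter is $\zeta^{(k)}=\max(\zeta(u_1),\dots,\zeta(u_k))$. Writing $\mathcal{U}_k=(u_1|\cdots|u_k)$, one thus has $\mathcal{T}(z)\mathcal{U}_k=\mathcal{U}_kH_k+\beta_{k+1}u_{k+1}e_k^T+\Delta\mathcal{U}_k$ with $\Delta\mathcal{U}_k=(\Delta u_1|\cdots|\Delta u_k)$ and $\|\Delta u_j\|\le\zeta^{(k)}\xi^{3/2}\epsilon_m$. No orthogonality of the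 $u_j$ is assumed. In the claim, $j$ is any index in $\{1,\dots,k\}$, and the minimum in the separation condition is over indices $i\neq j$ (the condition is vacuous for $k=1$). *)

(* Defs.v *)
From HB Require Import structures.
From mathcomp Require Import all_boot all_order all_algebra sesquilinear.
From mathcomp Require Import all_classical all_reals all_analysis.
From mathcomp Require Import complex.

Set Implicit Arguments.
Unset Strict Implicit.
Unset Printing Implicit Defensive.

Import Order.TTheory GRing.Theory Num.Theory.
Import numFieldNormedType.Exports.

Local Open Scope classical_set_scope.
Local Open Scope ring_scope.
Local Open Scope complex_scope.

Section HilbertOperators.
Context {R : realType} {H : completeNormedModType R[i]}.

(* The library norm of H takes its values in R[i]; they are nonnegative reals,
   and realnorm is the same norm with values in R. *)
Definition realnorm (x : H) : R := complex.Re `|x|.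

(* {dot H for Num.conj} is the type of positive definite Hermitian forms,
   linear in the first argument. *)
Definition norm_from_dot (dot : {dot H for (@Num.conj R[i])}) : Prop :=
  forall x : H, `|x| ^+ 2 = dot x x.

Definition separable_space : Prop :=
  exists2 A : set H, countable A & dense A.

(* A possibly unbounded operator is a domain D together with a function L
   whose values outside D are irrelevant. *)
Definition linear_on (D : set H) (L : H -> H) : Prop :=
  D 0 /\ forall (a : R[i]) (x y : H), D x -> D y ->
    D (a *: x + y) /\ L (a *: x + y) = a *: L x + L y.

Definition closed_operator (D : set H) (L : H -> H) : Prop :=
  linear_on D L /\ closed [set p : H * H | D p.1 /\ p.2 = L p.1].

(* B is the bounded everywhere defined inverse of z I - L : D -> H. *)
Definition is_resolvent (D : set H) (L : H -> H) (z : R[i])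
    (B : {linear H -> H}) : Prop :=
  [/\ continuous B,
      forall x, D (B x) /\ z *: B x - L (B x) = x
    & forall x, D x -> B (z *: x - L x) = x].

Definition resolvent_set (D : set H) (L : H -> H) : set R[i] :=
  [set z | exists B : {linear H -> H}, is_resolvent D L z B].

Definition spectrum (A : H -> H) : set R[i] := ~` resolvent_set setT A.

Definition is_adjoint (dot : {dot H for (@Num.conj R[i])})
    (A B : {linear H -> H}) : Prop :=
  forall x y : H, dot (A x) y = dot x (B y).

Definition opnorm (A : H -> H) : R :=
  sup [set realnorm (A x) | x in [set x | realnorm x <= 1]].

Definition lanczos_p (u w : nat -> H) (beta : nat -> R) (j : nat) : H :=
  if j == 1%N then w 1%N else w j - (beta j)%:C *: u j.-1.

Definition lanczos_q (u w : nat -> H) (alpha beta : nat -> R) (j : nat) : H :=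
  lanczos_p u w beta j - (alpha j)%:C *: u j.

(* Indices run from 1 as in the usual presentation: u 0, w 0, alpha 0, beta 0
   and beta 1 play no role. *)
Record perturbed_lanczos (dot : {dot H for (@Num.conj R[i])}) (T : H -> H)
    (epsm : R) (zeta : H -> R) (k : nat) (u w : nat -> H)
    (alpha beta : nat -> R) : Prop := PerturbedLanczos {
  lanczos_start : realnorm (u 1%N) = 1;
  lanczos_zeta_gt0 : forall j, (1 <= j <= k)%N -> 0 < zeta (u j);
  lanczos_error : forall j, (1 <= j <= k)%N ->
    realnorm (T (u j) - w j)
      <= zeta (u j) * opnorm T `^ (3 / 2) * epsm * realnorm (u j);
  lanczos_alpha : forall j, (1 <= j <= k)%N ->
    alpha j = complex.Re (dot (u j) (lanczos_p u w beta j));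
  lanczos_beta : forall j, (1 <= j <= k)%N ->
    beta j.+1 = realnorm (lanczos_q u w alpha beta j);
  lanczos_beta_neq0 : forall j, (1 <= j <= k)%N -> beta j.+1 != 0;
  lanczos_next : forall j, (1 <= j <= k)%N ->
    u j.+1 = ((beta j.+1)^-1)%:C *: lanczos_q u w alpha beta j }.

Definition max_zeta (zeta : H -> R) (u : nat -> H) (k : nat) : R :=
  \big[Num.max/0]_(1 <= j < k.+1) zeta (u j).

End HilbertOperators.

Arguments separable_space {R} H.

(* Matrix indices start at 0, while alpha and beta are indexed from 1: the
   diagonal is alpha 1, ..., alpha k and the off-diagonal beta 2, ..., beta k. *)
Definition tridiag {R : realType} (alpha beta : nat -> R) (k : nat) : 'M[R]_k :=
  \matrix_(i < k, j < k)
    if i == j then alpha i.+1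
    else if i.+1 == j :> nat then beta j.+1
    else if j.+1 == i :> nat then beta i.+1
    else 0.

(* Extended real, so that the distance to the empty set is +oo. *)
Definition dist_to_set {R : realType} (x : R[i]) (S : set R[i]) : \bar R :=
  ereal_inf [set (complex.Re `|x - y|)%:E | y in S].

(* Main.v *)
(* In the real inner product Re <x, y> consecutive Lanczos vectors are exactly
   orthogonal, which allows an analysis in the style of Paige. Let R be the
   strictly upper triangular part of the Gram matrix of u_1, ..., u_k and y
   the j-th eigenvector of H_k; then |U_k y|^2 = 1 + 2 y^T R y. For t < k put
   S = (H_t - mu_j)^-1 and let R_t be the leading block of R. The commutator
   [H_t, R_t] is the sum of a rank one term and of an error matrix D_t, and tr
   (S [H_t, R_t]) = 0, so that column t + 1 of R contributes y_{t+1}^2 tr (S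
   D_t) to y^T R y. The separation of mu_j gives |y_{t+1}^2 S| <= 1 / gap,
   hence |y^T R y| <= 2/5 and |U_k y| >= 5^{-1/2} > 2/5. The residual of the
   Ritz pair (mu_j, U_k y) divided by |U_k y| bounds the distance from mu_j to
   the spectrum, because T(z) is bounded and self-adjoint. *)
Require Import Defs.
From HB Require Import structures.
From mathcomp Require Import all_boot all_order all_algebra sesquilinear.
From mathcomp Require Import all_classical all_reals all_analysis.
From mathcomp Require Import complex.
From mathcomp Require Import ring lra zify.

Set Implicit Arguments.
Unset Strict Implicit.
Unset Printing Implicit Defensive.

Import Order.TTheory GRing.Theory Num.Theory.
Import numFieldNormedType.Exports.

Local Open Scope classical_set_scope.
Local Open Scope ring_scope.
Local Open Scope complex_scope.

(** * Real norm and real inner product on the complex space *)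

Section RealStructure.
Context {R : realType} {H : completeNormedModType R[i]}.
Implicit Types (x y : H) (r : R).

Lemma normE x : `|x| = (realnorm x)%:C.
Proof. by rewrite /realnorm RRe_real// ger0_real. Qed.

Lemma realnorm_ge0 x : 0 <= realnorm x.
Proof. by rewrite -ler0c -normE. Qed.

Lemma realnorm_eq0 x : (realnorm x == 0) = (x == 0).
Proof. by rewrite -[RHS]normr_eq0 normE -(inj_eq (@complexI R)). Qed.

Lemma realnorm0 : realnorm (0 : H) = 0.
Proof. by apply/eqP; rewrite realnorm_eq0. Qed.

Lemma realnormD x y : realnorm (x + y) <= realnorm x + realnorm y.
Proof. by rewrite -lecR rmorphD/= -!normE ler_normD. Qed.

Lemma realnormZ r x : realnorm (r%:C *: x) = `|r| * realnorm x.
Proof.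
apply: (@complexI R); rewrite -normE normrZ normE rmorphM/=; congr (_ * _).
by rewrite normc_def/= expr0n/= addr0 sqrtr_sqr.
Qed.

Lemma realnorm_sum (I : Type) (s : seq I) (F : I -> H) :
  realnorm (\sum_(i <- s) F i) <= \sum_(i <- s) realnorm (F i).
Proof.
elim/big_rec2 : _ => [|i a x _ h]; first by rewrite realnorm0.
by rewrite (le_trans (realnormD _ _))// lerD2l.
Qed.

Lemma linear_realnorm_bound (B : {linear H -> H}) : continuous B ->
  exists2 K : R, 0 < K & forall x, realnorm (B x) <= K * realnorm x.
Proof.
move=> /(_ 0) /continuous_linear_bounded /linear_boundedP /pinfty_ex_gt0.
move=> [K K0 hK]; have KE : K = (complex.Re K)%:C by rewrite RRe_real// gtr0_real.
exists (complex.Re K) => [|x]; first by rewrite -ltcR -KE.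
by rewrite -lecR rmorphM/= -KE -!normE.
Qed.

Context (dot : {dot H for (@Num.conj R[i])}).

(** Since [alpha] is a real part, a Lanczos step guarantees orthogonality to the previous vector
    only for the real part of the form. *)
Definition rdot x y : R := complex.Re (dot x y).

Lemma rdotDl x y z : rdot (x + y) z = rdot x z + rdot y z.
Proof. by rewrite /rdot linearDl raddfD. Qed.

Lemma rdotDr x y z : rdot x (y + z) = rdot x y + rdot x z.
Proof. by rewrite /rdot linearDr raddfD. Qed.

Lemma rdotC x y : rdot x y = rdot y x.
Proof. by rewrite /rdot (@hermC _ _ _ _ dot)/= expr0 mul1r; case: (dot y x). Qed.

Lemma rdotZl r x y : rdot (r%:C *: x) y = r * rdot x y.
Proof. by rewrite /rdot linearZl_LR/=; case: (dot x y) => a b /=; rewrite mul0r subr0. Qed.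

Lemma rdotZr r x y : rdot x (r%:C *: y) = r * rdot x y.
Proof. by rewrite rdotC rdotZl rdotC. Qed.

Lemma rdot0l x : rdot 0 x = 0.
Proof. by rewrite /rdot linear0l. Qed.

Lemma rdotNl x y : rdot (- x) y = - rdot x y.
Proof. by rewrite /rdot linearNl raddfN. Qed.

Lemma rdotBl x y z : rdot (x - y) z = rdot x z - rdot y z.
Proof. by rewrite rdotDl rdotNl. Qed.

Lemma rdotBr x y z : rdot x (y - z) = rdot x y - rdot x z.
Proof. by rewrite rdotC rdotBl !(rdotC x). Qed.

Lemma rdot_suml (I : Type) (s : seq I) (F : I -> H) y :
  rdot (\sum_(i <- s) F i) y = \sum_(i <- s) rdot (F i) y.
Proof.
elim/big_rec2 : _ => [|i a x _ <-]; first by rewrite rdot0l.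
by rewrite rdotDl.
Qed.

Context (dot_norm : norm_from_dot dot).

Lemma rdotE x : rdot x x = realnorm x ^+ 2.
Proof. by rewrite /rdot -dot_norm normE -rmorphXn. Qed.

Lemma rdot_ge0 x : 0 <= rdot x x.
Proof. by rewrite rdotE exprn_ge0// realnorm_ge0. Qed.

Lemma rdot_CauchySchwarz x y : `|rdot x y| <= realnorm x * realnorm y.
Proof.
have [->|y0] := eqVneq y 0; first by rewrite rdotC rdot0l normr0 realnorm0 mulr0.
have {y0}y0 : 0 < realnorm y by rewrite lt_def realnorm_eq0 y0 realnorm_ge0.
rewrite -(@ler_pXn2r _ 2)// ?nnegrE ?mulr_ge0 ?realnorm_ge0//.
rewrite real_normK ?num_real// exprMn -!rdotE.
(* This vector is [rdot y y] times the component of [x] orthogonal to [y]. *)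
have := rdot_ge0 ((rdot y y)%:C *: x - (rdot x y)%:C *: y).
rewrite !(rdotBl, rdotBr, rdotZl, rdotZr) (rdotC y x).
rewrite -subr_ge0 -[in X in _ -> X](@pmulr_rge0 _ (rdot y y)) ?rdotE ?exprn_gt0//.
by rewrite -!rdotE; nra.
Qed.

End RealStructure.

(** * Distance from a real number to the spectrum of a bounded symmetric operator *)

Section SymmetricOperator.
Context {R : realType} {H : completeNormedModType R[i]}.
Context (dot : {dot H for (@Num.conj R[i])}) (dot_norm : norm_from_dot dot).
Local Notation rdot := (rdot dot).

(* Cauchy-Schwarz for the positive semidefinite form x, y |-> <P x, y>. *)
Lemma psd_realnorm_le (P : {linear H -> H}) (C : R) (x : H) : 0 < C ->
  (forall y z, rdot (P y) z = rdot y (P z)) ->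
  (forall y, 0 <= rdot (P y) y <= C * realnorm y ^+ 2) ->
  realnorm (P x) ^+ 2 <= C * rdot (P x) x.
Proof.
move=> C0 Psym Ppos; rewrite -(rdotE dot_norm).
have /andP[_] := Ppos (P x); rewrite -(rdotE dot_norm).
(* Expanded, this is C^2 <P x, x> - 2 C |P x|^2 + <P P x, P x> >= 0; the upper bound at [P x]
   replaces the last term by C |P x|^2. *)
have /andP[+ _] := Ppos (C%:C *: x - P x).
rewrite linearB linearZ/= !(rdotBl, rdotBr, rdotZl, rdotZr) (Psym (P x) x).
rewrite -subr_ge0 => h1 h2; rewrite -subr_ge0 -(pmulr_rge0 _ C0).
by move: h1 h2; nra.
Qed.

Context (T : {linear H -> H}) (K : R).
Context (T_bound : forall x, realnorm (T x) <= K * realnorm x).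
Context (T_sym : forall x y, rdot (T x) y = rdot x (T y)).

(* With S = T - mu and m = inf |S x| / |x|, the operator S^2 - m^2 is positive
   and not bounded below, so one of mu + m, mu - m is in the spectrum. *)
Lemma dist_spectrum_le (mu : R) (x : H) : x != 0 ->
  (dist_to_set mu%:C (spectrum T)
     <= (realnorm (T x - mu%:C *: x) / realnorm x)%:E)%E.
Proof.
move=> x0; have [S SE] : exists S : {linear H -> H}, forall y, S y = T y - mu%:C *: y.
  by exists (T \- mu%:C \*: idfun).
rewrite -SE.
have nz (y : H) : y != 0 -> 0 < realnorm y.
  by move=> y0; rewrite lt_def realnorm_eq0 y0 realnorm_ge0.
pose E := [set realnorm (S y) / realnorm y | y in [set y | y != 0]].
have E0 : lbound E 0 by move=> _ [y _ <-]; rewrite divr_ge0 ?realnorm_ge0.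
have Ex : E (realnorm (S x) / realnorm x) by exists x.
pose m := inf E.
have Einf : has_inf E by split; [exists (realnorm (S x) / realnorm x) | exists 0].
have m0 : 0 <= m by apply: lb_le_inf => //; case: Einf.
have mle y : m * realnorm y <= realnorm (S y).
  have [->|y0] := eqVneq y 0; first by rewrite realnorm0 mulr0 realnorm_ge0.
  by rewrite -ler_pdivlMr ?nz//; apply: ge_inf; [case: Einf | exists y].
have distE l : `|mu - l| = m -> spectrum T l%:C ->
    (dist_to_set mu%:C (spectrum T) <= m%:E)%E.
  move=> <- sl; apply: ereal_inf_lbound; exists l%:C => //.
  by rewrite -rmorphB normc_def/= expr0n/= addr0 sqrtr_sqr.
have {}distE : spectrum T (mu + m)%:C \/ spectrum T (mu - m)%:C ->
    (dist_to_set mu%:C (spectrum T) <= m%:E)%E.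
  case; apply: distE; first by rewrite opprD addNKr normrN ger0_norm.
  by rewrite opprB addrC subrK ger0_norm.
apply: (@le_trans _ _ m%:E); last by rewrite lee_fin; apply: ge_inf; first case: Einf.
(* Otherwise both points lie in the resolvent set, with [B1] inverse to m - S and [B2] inverse to -
   m - S. *)
apply: distE; apply: contrapT => /not_orP[/contrapT[B1 [c1 _ r1]] /contrapT[B2 [c2 _ r2]]].
have [K1 K1_gt0 hK1] := linear_realnorm_bound c1.
have [K2 K2_gt0 hK2] := linear_realnorm_bound c2.
have [Pl PlE] : exists Pl : {linear H -> H},
    forall y, Pl y = S (S y) - (m ^+ 2)%:C *: y.
  by exists ((S \o S) \- (m ^+ 2)%:C \*: idfun).
have Ssym y z : rdot (S y) z = rdot y (S z).
  by rewrite !SE rdotBl rdotBr rdotZl rdotZr T_sym.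
have Psym y z : rdot (Pl y) z = rdot y (Pl z).
  by rewrite !PlE rdotBl rdotBr rdotZl rdotZr !Ssym.
have Pform y : rdot (Pl y) y = realnorm (S y) ^+ 2 - m ^+ 2 * realnorm y ^+ 2.
  by rewrite PlE rdotBl rdotZl Ssym !(rdotE dot_norm).
(* Bounds the squared norm of [S]; the summand 1 makes it positive. *)
pose C := (`|K| + `|mu| + 1) ^+ 2.
have C0 : 0 < C by rewrite exprn_gt0// ltr_wpDl// addr_ge0.
have Ppos y : 0 <= rdot (Pl y) y <= C * realnorm y ^+ 2.
  rewrite Pform subr_ge0 -!exprMn ler_pXn2r ?nnegrE ?mulr_ge0 ?realnorm_ge0// mle/=.
  rewrite lerBlDr ler_wpDr ?exprn_ge0 ?mulr_ge0 ?realnorm_ge0//.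
  rewrite ler_pXn2r ?nnegrE ?mulr_ge0 ?addr_ge0 ?realnorm_ge0//.
  rewrite SE -scaleNr -rmorphN/=; apply: le_trans (realnormD _ _) _.
  rewrite realnormZ normrN; have := T_bound y; have := realnorm_ge0 y.
  have := ler_norm K; nra.
(* S^2 - m^2 factors as (m - S)(- m - S), so [B1] and [B2] undo it one factor at a time. *)
have Pinv y : realnorm y <= K1 * K2 * realnorm (Pl y).
  have e1 : B1 (Pl y) = - (m%:C *: y) - S y.
    rewrite -[RHS]r1//; congr (B1 _); rewrite PlE.
    set v := - (m%:C *: y) - S y; rewrite rmorphD/= scalerDl [RHS]addrAC.
    rewrite -[mu%:C *: v - T v]opprB -SE /v linearB linearN [S (_ *: _)]linearZ/= scalerBr !scalerN scalerA.
    rewrite -rmorphM -expr2.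
    by rewrite opprB opprK addrACA subrr addr0.
  have e2 : B2 (- (m%:C *: y) - S y) = y.
    rewrite -[RHS]r2//; congr (B2 _); rewrite rmorphB/= scalerBl SE.
    by rewrite opprB addrCA addrA.
  rewrite -{1}e2 -e1; apply: le_trans (hK2 _) _.
  by rewrite (mulrC K1) -mulrA ler_pM2l.
pose C' := (K1 * K2) ^+ 2 * C.
have C'0 : 0 < C' by rewrite mulr_gt0// exprn_gt0// mulr_gt0.
(* [psd_realnorm_le] bounds |P y| by the quadratic form of P, whence |S y|^2 >= (m^2 + 1/C') |y|^2,
   which is more than the infimum [m] allows. *)
have low y : realnorm y ^+ 2 <= C' * (realnorm (S y) ^+ 2 - m ^+ 2 * realnorm y ^+ 2).
  rewrite -Pform /C' -mulrA.
  apply: le_trans (_ : (K1 * K2 * realnorm (Pl y)) ^+ 2 <= _).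
    by rewrite ler_pXn2r ?nnegrE ?mulr_ge0 ?realnorm_ge0// ltW.
  by rewrite exprMn ler_wpM2l ?psd_realnorm_le// exprn_ge0// mulr_ge0// ltW.
have sm : Num.sqrt (m ^+ 2 + C'^-1) <= m.
  apply: lb_le_inf; first by case: Einf.
  move=> _ [y y0 <-]; have ny := nz y y0.
  rewrite -[leRHS]ger0_norm ?divr_ge0 ?realnorm_ge0//.
  rewrite -sqrtr_sqr ler_sqrt ?exprn_ge0 ?divr_ge0 ?realnorm_ge0//.
  rewrite expr_div_n ler_pdivlMr ?exprn_gt0// mulrDl -lerBrDl.
  by rewrite -(ler_pM2l C'0) mulrA mulfV ?gt_eqF// mul1r.
have : m ^+ 2 + C'^-1 <= m ^+ 2.
  rewrite -[leLHS]sqr_sqrtr; last by rewrite addr_ge0 ?exprn_ge0// invr_ge0 ltW.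
  by rewrite ler_pXn2r ?nnegrE ?sqrtr_ge0.
by rewrite gerDl leNgt invr_gt0 C'0.
Qed.

End SymmetricOperator.

(** * Finite sums and rows of a tridiagonal matrix *)

Lemma sum_CauchySchwarz (R : realFieldType) (I : finType) (P : pred I) (f g : I -> R) :
  (\sum_(i | P i) f i * g i) ^+ 2
    <= (\sum_(i | P i) f i ^+ 2) * (\sum_(i | P i) g i ^+ 2).
Proof.
set p := \sum_(i | _) _; set A := \sum_(i | _) f i ^+ 2; set B := \sum_(i | _) _.
have A0 : 0 <= A by apply: sumr_ge0 => i _; exact: sqr_ge0.
have key s : 0 <= s ^+ 2 * A - 2 * s * p + B.
  have -> : s ^+ 2 * A - 2 * s * p + B = \sum_(i | P i) (s * f i - g i) ^+ 2.
    rewrite !mulr_sumr -sumrB -big_split/=; apply: eq_bigr => i _; ring.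
  by apply: sumr_ge0 => i _; exact: sqr_ge0.
have [A1|A1] := eqVneq A 0.
  have f0 i : P i -> f i = 0.
    move=> Pi; have /eqP := A1; rewrite psumr_eq0 => [|l _]; last exact: sqr_ge0.
    by move=> /allP/(_ i (mem_index_enum _)); rewrite Pi/= sqrf_eq0 => /eqP.
  by rewrite /p big1 ?A1 ?mul0r ?expr0n// => i /f0 ->; rewrite mul0r.
have {}A0 : 0 < A by rewrite lt_def A1.
(* The value p / A minimises the quadratic in [key]. *)
have := key (p / A); rewrite -(pmulr_rge0 _ A0).
have -> : A * ((p / A) ^+ 2 * A - 2 * (p / A) * p + B) = A * B - p ^+ 2 by field.
by rewrite subr_ge0.
Qed.

Lemma sum_ord_delta (V : zmodType) (t m : nat) (F : nat -> V) :
  \sum_(l < t) (if l == m :> nat then F l else 0) = if (m < t)%N then F m else 0.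
Proof.
rewrite -big_mkcond/=; case: ifPn => [mt|].
  by rewrite (big_pred1 (Ordinal mt)).
rewrite -leqNgt => tm; rewrite big_pred0// => l.
by apply/negbTE; rewrite neq_ltn (leq_trans (ltn_ord l) tm).
Qed.

Lemma sum_neighbours (V : zmodType) (t : nat) (i : 'I_t) (F : nat -> V) :
  (forall l : nat, l != i -> l != i.+1 -> l.+1 != i -> F l = 0) ->
  \sum_(l < t) F l = F i + (if (i.+1 < t)%N then F i.+1 else 0)
                         + (if (0 < i)%N then F i.-1 else 0).
Proof.
move=> F0; transitivity (\sum_(l < t) ((if l == i :> nat then F l else 0)
    + (if l == i.+1 :> nat then F l else 0)
    + (if (0 < i)%N then if l == i.-1 :> nat then F l else 0 else 0))).
  apply: eq_bigr => l _; case: (eqVneq (l : nat) i) => [->|li].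
    by rewrite ltn_eqF// addr0; case: posnP => i0; rewrite ?addr0// ifN ?addr0//; lia.
  case: (eqVneq (l : nat) i.+1) => [->|li1].
    by rewrite add0r; case: posnP => i0; rewrite ?addr0// ifN ?addr0//; lia.
  rewrite !add0r; case: posnP => [i0|i0].
    by rewrite F0//; lia.
  by case: eqVneq => // li2; rewrite F0//; lia.
rewrite !big_split/= !sum_ord_delta ltn_ord; congr (_ + _).
case: posnP => i0; first by rewrite big1.
by rewrite sum_ord_delta ifT//; have := ltn_ord i; lia.
Qed.

Lemma trmx_tridiag (R : realType) (alpha beta : nat -> R) (t : nat) :
  (tridiag alpha beta t)^T = tridiag alpha beta t.
Proof.
apply/matrixP => i l; rewrite !mxE eq_sym; case: eqVneq => [->//|_].
by case: eqVneq => [e|_]; case: eqVneq => [e'|//]; first by move: e; rewrite -e'; lia.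
Qed.

(** [act] is abstract so that one expansion serves both products in [R] and real multiples of
    vectors of [H]. *)
Lemma tridiag_row_sum (R : realType) (V : zmodType) (act : R -> V -> V)
    (alpha beta : nat -> R) (t : nat) (i : 'I_t) (f : nat -> V) :
  (forall v, act 0 v = 0) ->
  \sum_(l < t) act (tridiag alpha beta t i l) (f l) =
    act (alpha i.+1) (f i)
      + (if (i.+1 < t)%N then act (beta i.+2) (f i.+1) else 0)
      + (if (0 < i)%N then act (beta i.+1) (f i.-1) else 0).
Proof.
move=> act0; pose F (l : nat) := act (if i == l :> nat then alpha i.+1
  else if i.+1 == l then beta l.+1 else if l.+1 == i then beta i.+1 else 0) (f l).
rewrite (eq_bigr (fun l : 'I_t => F l)) => [|l _]; last by rewrite mxE.
rewrite (@sum_neighbours _ _ i) => [|l]; last first.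
  by rewrite /F ![_ == l]eq_sym => /negPf -> /negPf -> /negPf ->; rewrite act0.
rewrite /F eqxx ltn_eqF// eqxx; congr (_ + _); case: posnP => // i0.
rewrite prednK// eqxx; have [-> ->] //: (i == i.-1 :> nat) = false /\ (i.+1 == i.-1) = false.
by lia.
Qed.

Lemma tridiag_mulE (R : realType) (alpha beta : nat -> R) (t : nat) (i : 'I_t)
    (f : nat -> R) :
  \sum_(l < t) tridiag alpha beta t i l * f l =
    alpha i.+1 * f i + (if (i.+1 < t)%N then beta i.+2 * f i.+1 else 0)
                     + (if (0 < i)%N then beta i.+1 * f i.-1 else 0).
Proof. by apply: (@tridiag_row_sum _ _ *%R) => v; rewrite mul0r. Qed.

(** * Spectral gap estimates for a symmetric matrix *)

Section EigenvectorGap.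
Context {R : realType} {k : nat} (A Y : 'M[R]_k) (mu : 'I_k -> R).
Context (A_sym : A^T = A) (A_eig : A *m Y = Y *m diag_mx (\row_i mu i)).
Context (Y_orth : Y^T *m Y = 1%:M).

Lemma sum_sqr_mulmx (B : 'M[R]_k) (v : 'cV_k) : B^T *m B = 1%:M ->
  \sum_i (B *m v) i 0 ^+ 2 = \sum_i v i 0 ^+ 2.
Proof.
move=> BB; have sq (w : 'cV[R]_k) : \sum_i w i 0 ^+ 2 = (w^T *m w) 0 0.
  by rewrite mxE; apply: eq_bigr => i _; rewrite mxE expr2.
by rewrite !sq trmx_mul mulmxA -(mulmxA _ B^T) BB mulmx1.
Qed.

(** In the eigenbasis, A - mu_j multiplies component i by mu_i - mu_j, of size at least [g] for i
    different from j. The bracket is the squared norm of [v] without its component along eigenvector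
    j. *)
Lemma eigenvector_gap (j : 'I_k) (g : R) (v : 'cV_k) : 0 <= g ->
  (forall i, i != j -> g <= `|mu j - mu i|) ->
  g ^+ 2 * (\sum_i v i 0 ^+ 2 - (\sum_i Y i j * v i 0) ^+ 2)
    <= \sum_i ((A *m v) i 0 - mu j * v i 0) ^+ 2.
Proof.
move=> g0 gap; have YY := mulmx1C Y_orth; pose w := Y^T *m v.
have vE : v = Y *m w by rewrite /w mulmxA YY mul1mx.
have wj : \sum_i Y i j * v i 0 = w j 0.
  by rewrite /w mxE; apply: eq_bigr => i _; rewrite mxE.
have -> : \sum_i v i 0 ^+ 2 = \sum_i w i 0 ^+ 2 by rewrite vE sum_sqr_mulmx.
rewrite wj (bigD1 j)//= addrAC subrr add0r.
pose r : 'cV_k := \col_i ((mu i - mu j) * w i 0).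
have -> : \sum_i ((A *m v) i 0 - mu j * v i 0) ^+ 2 = \sum_i r i 0 ^+ 2.
  rewrite -(sum_sqr_mulmx _ Y_orth); apply: eq_bigr => i _; congr (_ ^+ 2).
  have -> : r = diag_mx (\row_i mu i) *m w - mu j *: w.
    by apply/colP => l; rewrite mul_diag_mx !mxE mulrBl.
  by rewrite mulmxBr -scalemxAr mulmxA -A_eig -mulmxA -vE !mxE.
rewrite [leRHS](bigD1 j)//= [r j 0]mxE subrr mul0r expr0n/= add0r mulr_sumr.
apply: ler_sum => i ij; rewrite [r i 0]mxE exprMn ler_wpM2r ?sqr_ge0//.
by rewrite -[leRHS]real_normK ?num_real// ler_pXn2r ?nnegrE// distrC gap.
Qed.

Lemma eigenvector_sqr_sum (j : 'I_k) : \sum_i Y i j ^+ 2 = 1.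
Proof.
have := congr1 (fun M : 'M[R]_k => M j j) Y_orth; rewrite !mxE eqxx => h; rewrite -[RHS]h.
by apply: eq_bigr => i _; rewrite mxE expr2.
Qed.

Lemma mulmx_eigencol (j : 'I_k) : A *m col j Y = mu j *: col j Y.
Proof.
rewrite [in LHS]colE mulmxA A_eig -colE; apply/colP => i; rewrite !mxE (bigD1 j)//= big1 => [|l lj].
  by rewrite !mxE eqxx mulr1n addr0 mulrC.
by rewrite !mxE (negPf lj) mulr0n mulr0.
Qed.

(* Row p is the only one in which (A - mu j) v may differ from the image of v
   under the matrix with row and column p deleted; orthogonality of (A - mu j) v
   to the eigenvector controls that entry. *)
Lemma deleted_row_gap (j p : 'I_k) (g : R) (v : 'cV_k) : 0 <= g ->
  (forall i, i != j -> g <= `|mu j - mu i|) -> v p 0 = 0 ->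
  (Y p j ^+ 2 * g) ^+ 2 * (\sum_i v i 0 ^+ 2)
    <= \sum_(i | i != p) ((A *m v) i 0 - mu j * v i 0) ^+ 2.
Proof.
move=> g0 gap vp; have := eigenvector_gap v g0 gap.
pose r i := (A *m v) i 0 - mu j * v i 0.
have orth : \sum_i Y i j * r i = 0.
  have dotE (w : 'cV[R]_k) : \sum_i Y i j * w i 0 = ((col j Y)^T *m w) 0 0.
    by rewrite mxE; apply: eq_bigr => i _; rewrite !mxE.
  transitivity (\sum_i Y i j * (A *m v - mu j *: v) i 0).
    by apply: eq_bigr => i _; rewrite /r !mxE.
  rewrite dotE mulmxBr mulmxA -{1}A_sym -trmx_mul mulmx_eigencol linearZ/=.
  by rewrite -scalemxAl -scalemxAr subrr mxE.
have eta1 : \sum_(i | i != p) Y i j ^+ 2 = 1 - Y p j ^+ 2.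
  by rewrite -(eigenvector_sqr_sum j) [in RHS](bigD1 p)//= addrAC subrr add0r.
rewrite -/(r _); set V := \sum_i _ ^+ 2; set q := \sum_i _ * _.
have -> : \sum_i ((A *m v) i 0 - mu j * v i 0) ^+ 2
    = r p ^+ 2 + \sum_(i | i != p) r i ^+ 2 by rewrite (bigD1 p).
set rho := \sum_(i | _) _; rewrite -/rho => h.
(* By [orth], the term of row [p] is minus the sum over the other rows, to which Cauchy-Schwarz
   applies. *)
have hr : Y p j ^+ 2 * r p ^+ 2 <= (1 - Y p j ^+ 2) * rho.
  rewrite -eta1 -exprMn; apply: le_trans (sum_CauchySchwarz _ _ _).
  by move: orth; rewrite (bigD1 p)//= => /addr0_eq <-; rewrite sqrrN.
have hq : q ^+ 2 <= (1 - Y p j ^+ 2) * V.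
  have VE : V = \sum_(i | i != p) v i 0 ^+ 2.
    by rewrite /V (bigD1 p)//= vp expr0n/= add0r.
  have qE : q = \sum_(i | i != p) Y i j * v i 0.
    by rewrite /q (bigD1 p)//= vp mulr0 add0r.
  by rewrite -eta1 VE qE; exact: sum_CauchySchwarz.
set e := Y p j ^+ 2 in hr hq *.
have e0 : 0 <= e by exact: sqr_ge0.
have h1 : g ^+ 2 * (e * V) <= r p ^+ 2 + rho.
  by apply: le_trans h; rewrite ler_wpM2l ?sqr_ge0//; lra.
(* [hr] gives e (r_p^2 + rho) <= rho, which eliminates the entry of row [p] at the price of a second
   factor [e]. *)
have h2 : e * (g ^+ 2 * (e * V)) <= e * (r p ^+ 2 + rho) by rewrite ler_wpM2l.
by apply: le_trans (_ : e * (r p ^+ 2 + rho) <= _); [move: h2|]; nra.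
Qed.

End EigenvectorGap.

(** * Commutator of the tridiagonal matrix with the upper Gram matrix *)

Section GramCommutator.
Context {R : realType} (alpha beta : nat -> R) (k : nat) (G E : nat -> nat -> R).
Context (G_diag : forall i, (i < k)%N -> G i i = 1).
Context (G_next : forall i, (i.+1 < k)%N -> G i i.+1 = 0).
Context (G_rel : forall i l, (i < k)%N -> (l < k)%N ->
  beta l.+2 * G i l.+1 + alpha l.+1 * G i l
    + (if (0 < l)%N then beta l.+1 * G i l.-1 else 0) + E i l =
  beta i.+2 * G i.+1 l + alpha i.+1 * G i l
    + (if (0 < i)%N then beta i.+1 * G i.-1 l else 0) + E l i).

Let upper (i l : nat) : R := if (i < l)%N then G i l else 0.

Definition upper_gram (t : nat) : 'M[R]_t := \matrix_(i, l) upper i l.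

Definition gram_defect (t : nat) : 'M[R]_t :=
  \matrix_(i, l) if (i < l)%N then E i l - E l i else 0.

(** Above the diagonal this is [G_rel], which expresses the symmetry of T on two Lanczos vectors,
    [E i l] being the product of vector i with error l. In the last column the truncated matrix
    lacks the neighbour t + 1, and this missing term is the rank one part. On the diagonal [G_next]
    makes the neighbouring Gram entries vanish; below it both products are zero. *)
Lemma tridiag_upper_gram_commutator (t : nat) : (t.+1 < k)%N ->
  tridiag alpha beta t.+1 *m upper_gram t.+1
    - upper_gram t.+1 *m tridiag alpha beta t.+1
  = beta t.+2 *: ((\col_(i < t.+1) G i t.+1) *m delta_mx (0 : 'I_1) ord_max)
    + gram_defect t.+1.
Proof.
move=> tk; apply/matrixP => i l.
transitivity ((\sum_(m < t.+1) tridiag alpha beta t.+1 i m * upper m l)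
    - \sum_(m < t.+1) tridiag alpha beta t.+1 l m * upper i m).
  rewrite !mxE; congr (_ - _); apply: eq_bigr => m _; first by rewrite !mxE.
  by rewrite [upper_gram _ _ _]mxE -[tridiag _ _ _ in LHS]trmx_tridiag mxE mulrC.
rewrite (tridiag_mulE _ _ _ (fun m => upper m l)) (tridiag_mulE _ _ _ (upper i)).
rewrite !mxE big_ord1 !mxE eqxx/=.
have lt_l := ltn_ord l; have lt_i := ltn_ord i.
have -> : beta t.+2 * (G i t.+1 * (l == ord_max)%:R) = beta l.+2 * upper i l.+1
    - (if (l.+1 < t.+1)%N then beta l.+2 * upper i l.+1 else 0).
  have -> : (l == ord_max) = (l.+1 == t.+1) by [].
  case: ltnP => lt'; first by rewrite ltn_eqF// !mulr0 subrr.
  have -> : l.+1 = t.+1 by lia.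
  by rewrite eqxx mulr1 subr0 /upper lt_i.
have -> : (if (i.+1 < t.+1)%N then beta i.+2 * upper i.+1 l else 0)
    = beta i.+2 * upper i.+1 l.
  by case: ltnP => // lt'; rewrite /upper ltnNge (leq_trans _ lt') ?mulr0// ltnW.
have regroup (p s v x y e : R) : p - (s + y + v) = e -> p - (s + x + v) = y - x + e.
  by move=> <-; ring.
suff : alpha i.+1 * upper i l + beta i.+2 * upper i.+1 l
    + (if (0 < i)%N then beta i.+1 * upper i.-1 l else 0)
    - (alpha l.+1 * upper i l + beta l.+2 * upper i l.+1
    + (if (0 < l)%N then beta l.+1 * upper i l.-1 else 0))
    = if (i < l)%N then E i l - E l i else 0 by exact: regroup.
have ik : (i < k)%N by apply: leq_trans (ltnW tk).
have lk : (l < k)%N by apply: leq_trans (ltnW tk).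
case: (ltngtP i l) => [il|li|il].
- have rel := G_rel ik lk; have l0 : (0 < l)%N by lia.
  rewrite l0 in rel *.
  have -> : upper i l = G i l by rewrite /upper il.
  have -> : upper i l.+1 = G i l.+1 by rewrite /upper ltnS ltnW.
  have -> : (if (0 < i)%N then beta i.+1 * upper i.-1 l else 0)
      = (if (0 < i)%N then beta i.+1 * G i.-1 l else 0).
    by rewrite /upper (leq_ltn_trans (leq_pred _) il).
  (* On the first superdiagonal, [G_rel] also contains the diagonal entries that [upper] drops; they
     equal 1, carry the same coefficient and cancel. *)
  have [il1|il1] := eqVneq i.+1 l.
    have il' : l.-1 = i by rewrite -il1.
    move: rel; rewrite /upper il' il1 !ltnn !mulr0 !G_diag// (leqNgt l i) il/=; lra.
  have -> : upper i.+1 l = G i.+1 l by rewrite /upper ltn_neqAle il1 il.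
  have -> : upper i l.-1 = G i l.-1 by rewrite /upper ifT//; lia.
  by lra.
- rewrite /upper !ltnS (ltnNge i l) (ltnW li)/= (ltnNge i.+1) (leqW (ltnW li))/=.
  rewrite (leqNgt i l) li/= !mulr0 (ltnNge i l.-1).
  have -> : (l.-1 <= i)%N by lia.
  have -> : (i.-1 < l)%N = false by lia.
  by rewrite !mulr0 !if_same; lra.
- rewrite -il /upper ltnn (ltnNge i.+1) leqnSn/= ltnSn.
  rewrite (ltnNge i i.-1) leq_pred/= !mulr0 G_next; last by apply: leq_ltn_trans tk.
  case: posnP => i0; first by rewrite !mulr0; lra.
  have -> : G i.-1 i = 0 by rewrite -[i in G _ i](prednK i0) G_next// prednK.
  by rewrite prednK// leqnn !mulr0; lra.
Qed.

End GramCommutator.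

(** A lower Riemann sum for the integral of t^(3/2), which is where 2/5 and the power 5/2 come
    from. *)
Lemma sum_nat_mul_sqrt_le (R : realType) (m : nat) :
  \sum_(t < m) t%:R * Num.sqrt t%:R <= 2 / 5 * (m%:R ^+ 2 * Num.sqrt m%:R) :> R.
Proof.
elim: m => [|m ih]; first by rewrite big_ord0 expr0n/= mul0r mulr0.
rewrite big_ord_recr/=; apply: le_trans (lerD ih (lexx _)) _.
have := sqr_sqrtr (ler0n R m); have := sqr_sqrtr (ler0n R m.+1).
have : Num.sqrt m%:R <= Num.sqrt m.+1%:R :> R by rewrite ler_sqrt ?ler_nat.
have := sqrtr_ge0 (m%:R : R).
move: (Num.sqrt m%:R) (Num.sqrt m.+1%:R) => s s' s0 ss' s'2 s2.
have e : (s' - s) * (s' + s) = 1.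
  by rewrite -subr_sqr s'2 s2 -natr1 addrAC subrr add0r.
rewrite -s2 -s'2; have [d [d0 dE]] : exists d, 0 <= d /\ s' = s + d.
  by exists (s' - s); rewrite subr_ge0 addrC subrK.
rewrite {}dE in e *; have {e}e : s ^+ 3 = s ^+ 3 * (d * (2 * s + d)).
  by rewrite -[LHS]mulr1 -[X in _ * X = _]e; ring.
rewrite -subr_ge0; have -> : 2 / 5 * ((s + d) ^+ 2 ^+ 2 * (s + d))
    - (2 / 5 * (s ^+ 2 ^+ 2 * s) + s ^+ 2 * s)
  = 3 * s ^+ 3 * d ^+ 2 + 4 * s ^+ 2 * d ^+ 3 + 2 * s * d ^+ 4 + 2 / 5 * d ^+ 5
    + (s ^+ 3 * (d * (2 * s + d)) - s ^+ 3) by field.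
rewrite -e subrr addr0.
by rewrite !addr_ge0 ?mulr_ge0 ?exprn_ge0.
Qed.

(** * Gram sum weighted by a well separated eigenvector *)

Section RitzOverlap.
Context {R : realType} (alpha beta : nat -> R) (n : nat) (G E : nat -> nat -> R).
Context (G_diag : forall i, (i < n.+1)%N -> G i i = 1).
Context (G_next : forall i, (i.+1 < n.+1)%N -> G i i.+1 = 0).
Context (G_rel : forall i l, (i < n.+1)%N -> (l < n.+1)%N ->
  beta l.+2 * G i l.+1 + alpha l.+1 * G i l
    + (if (0 < l)%N then beta l.+1 * G i l.-1 else 0) + E i l =
  beta i.+2 * G i.+1 l + alpha i.+1 * G i l
    + (if (0 < i)%N then beta i.+1 * G i.-1 l else 0) + E l i).
Context (delta : R) (delta_ge0 : 0 <= delta).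
Context (E_le : forall i l, (i < n.+1)%N -> (l < n.+1)%N -> `|E i l| <= delta).
Context (Y : 'M[R]_n.+1) (mu : 'I_n.+1 -> R).
Context (Y_eig : tridiag alpha beta n.+1 *m Y = Y *m diag_mx (\row_i mu i)).
Context (Y_orth : Y^T *m Y = 1%:M).
Context (j : 'I_n.+1) (g : R) (g_gt0 : 0 < g).
Context (gap : forall i, i != j -> g <= `|mu j - mu i|).

Let y (i : nat) : R := Y (inord i) j.

Let shifted (t : nat) : 'M[R]_t := tridiag alpha beta t - (mu j)%:M.

Let shiftedE (t : nat) (f : nat -> R) (i : 'I_t) :
  (shifted t *m \col_l f l) i 0 =
    alpha i.+1 * f i + (if (i.+1 < t)%N then beta i.+2 * f i.+1 else 0)
      + (if (0 < i)%N then beta i.+1 * f i.-1 else 0) - mu j * f i.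
Proof.
rewrite mulmxBl mul_scalar_mx !mxE -tridiag_mulE; congr (_ - _).
by apply: eq_bigr => l _; rewrite [in X in _ * X]mxE.
Qed.

(** Pad [f] with zeros and delete row t + 1: the rows up to t are those of the leading block, and
    the rows after t + 1 vanish because the matrix is tridiagonal. *)
Let leading_gap (t : nat) (f : nat -> R) : (t.+1 < n.+1)%N ->
  (y t.+1 ^+ 2 * g) ^+ 2 * (\sum_(i < t.+1) f i ^+ 2)
    <= \sum_i (shifted t.+1 *m \col_l f l) i 0 ^+ 2.
Proof.
move=> tn; pose f' (l : nat) := if (l < t.+1)%N then f l else 0.
pose v : 'cV[R]_n.+1 := \col_l f' l.
have vp : v (inord t.+1) 0 = 0 by rewrite mxE /f' inordK// ltnn.
have := deleted_row_gap (trmx_tridiag alpha beta n.+1) Y_eig Y_orth (ltW g_gt0) gap vp.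
have -> : \sum_i v i 0 ^+ 2 = \sum_(i < t.+1) f i ^+ 2.
  rewrite (big_ord_widen n.+1 (fun i => f i ^+ 2)) 1?ltnW// [RHS]big_mkcond/=.
  by apply: eq_bigr => i _; rewrite mxE /f'; case: ifP; rewrite ?expr0n.
move/le_trans; apply; pose r (i : nat) :=
  alpha i.+1 * f' i + beta i.+2 * f' i.+1
      + (if (0 < i)%N then beta i.+1 * f' i.-1 else 0) - mu j * f' i.
rewrite [leRHS](eq_bigr (fun i : 'I_t.+1 => r i ^+ 2)) => [|i _]; last first.
  have it := ltn_ord i; rewrite shiftedE /r /f' it (leq_ltn_trans (leq_pred i) it).
  by case: ifP; rewrite ?mulr0.
rewrite (big_ord_widen n.+1 (fun i => r i ^+ 2)) 1?ltnW//.
rewrite [leLHS]big_mkcond [leRHS]big_mkcond/=; apply: ler_sum => i _.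
have -> : (tridiag alpha beta n.+1 *m v) i 0 - mu j * v i 0
    = (shifted n.+1 *m \col_l f' l) i 0.
  by rewrite mulmxBl mul_scalar_mx [RHS]mxE [X in _ = _ + X]mxE [X in _ = _ - X]mxE.
rewrite shiftedE; have in1 := ltn_ord i.
case: (ltnP i t.+1) => [it|ti].
  have ip : i != inord t.+1 by apply: contraTneq it => ->; rewrite -leqNgt inordK.
  have it' : (i.+1 < n.+1)%N by exact: leq_ltn_trans it tn.
  by rewrite ip it' /r.
case: (eqVneq i (inord t.+1)) => // ip.
have ti' : (t.+1 < i)%N.
  rewrite ltn_neqAle ti andbT; apply: contraNneq ip => e.
  by apply/eqP/val_inj; rewrite /= inordK.
have f0 l : (t < l)%N -> f' l = 0.
  by move=> tl; rewrite /f' ltnNge tl.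
rewrite (f0 i)// (f0 i.+1 (leqW ti)) (f0 i.-1); last by lia.
by rewrite !mulr0 !if_same !addr0 subr0 expr0n.
Qed.

(** Truncating the eigenvector equation loses only the coupling of the last row to entry t + 1. This
    makes the head of the eigenvector a multiple of the last column of the inverse block. *)
Let leading_eig (t : nat) : (t.+1 < n.+1)%N ->
  shifted t.+1 *m \col_l y l = - (beta t.+2 * y t.+1) *: delta_mx ord_max 0.
Proof.
move=> tn; apply/colP => i; have it := ltn_ord i.
have itn : (i < n.+1)%N by apply: ltn_trans tn.
have : (shifted n.+1 *m \col_l y l) (Ordinal itn) 0 = 0.
  have -> : \col_l y l = col j Y by apply/colP => l; rewrite !mxE /y inord_val.
  rewrite mulmxBl mul_scalar_mx (mulmx_eigencol Y_eig) subrr mxE//.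
rewrite !shiftedE/= ifT; last by apply: leq_ltn_trans tn.
rewrite !mxE eqxx andbT (_ : (i == ord_max) = (i.+1 == t.+1))//.
case: (ltnP i.+1 t.+1) => it'; first by rewrite ltn_eqF// mulr0.
have -> : i = t :> nat by lia.
rewrite eqxx mulr1; have regroup (p q r s : R) :
  p + q + r - s = 0 -> p + 0 + r - s = - q by move=> ?; lra.
exact: regroup.
Qed.

(* With N = H_t - mu j and S = N^-1, the trace of S (N R - R N) vanishes, which
   turns the rank one part of the commutator into - tr (S D). *)
Lemma gram_column_bound (t : nat) : (t.+1 < n.+1)%N ->
  (y t.+1 * \sum_(a < t.+1) y a * G a t.+1) ^+ 2 * g ^+ 2
    <= 2 * delta ^+ 2 * t.+1%:R ^+ 3.
Proof.
move=> tn; have [->|eta0] := eqVneq (y t.+1) 0.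
  by rewrite mul0r expr0n/= mul0r !mulr_ge0// exprn_ge0.
set eta := y t.+1; set N := shifted t.+1.
have N_sym : N^T = N by rewrite /N /shifted linearB/= trmx_tridiag tr_scalar_mx.
have col_eta (x : 'cV[R]_t.+1) : x = \col_l (fun l : nat => x (inord l) 0) l.
  by apply/colP => l; rewrite !mxE inord_val.
have N_gap (x : 'cV[R]_t.+1) :
    (eta ^+ 2 * g) ^+ 2 * (\sum_i x i 0 ^+ 2) <= \sum_i (N *m x) i 0 ^+ 2.
  have := @leading_gap t (fun l : nat => x (inord l) 0) tn.
  by rewrite -col_eta; under eq_bigr do rewrite inord_val.
have eg0 : 0 < (eta ^+ 2 * g) ^+ 2 by rewrite exprn_gt0// mulr_gt0// exprn_even_gt0.
have N_unit : N \in unitmx.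
  rewrite unitmxE unitfE; apply/det0P => -[x x0 xN]; move/negP: x0; apply.
  have Nx : N *m x^T = 0 by rewrite -N_sym -trmx_mul xN trmx0.
  have := N_gap x^T; rewrite Nx [leRHS]big1 => [|i _]; last by rewrite mxE expr0n.
  rewrite pmulr_rle0// => h; apply/eqP/rowP => i; rewrite [RHS]mxE.
  have : \sum_i x^T i 0 ^+ 2 == 0 by rewrite eq_le h sumr_ge0// => l _; exact: sqr_ge0.
  rewrite psumr_eq0 => [|l _]; last exact: sqr_ge0.
  by move=> /allP/(_ i (mem_index_enum _)); rewrite mxE sqrf_eq0 => /eqP.
pose S := invmx N; have S_sym : S^T = S by rewrite /S trmx_inv N_sym.
pose Rm := upper_gram G t.+1; pose D := gram_defect E t.+1.
pose c : 'cV[R]_t.+1 := \col_(i < t.+1) G i t.+1.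
pose e : 'rV[R]_t.+1 := delta_mx 0 ord_max.
have comm : N *m Rm - Rm *m N = beta t.+2 *: (c *m e) + D.
  rewrite -(tridiag_upper_gram_commutator G_diag G_next G_rel tn) /N /shifted.
  rewrite mulmxBl mulmxBr mul_scalar_mx mul_mx_scalar opprB addrA.
  by rewrite subrK.
have traceSD : \tr (S *m D) = - beta t.+2 * (e *m S *m c) 0 0.
  have : \tr (S *m (N *m Rm - Rm *m N)) = 0.
    rewrite mulmxBr linearB/= !mulmxA mulVmx// mul1mx -mulmxA mxtrace_mulC.
    by rewrite -mulmxA mulmxV// mulmx1 subrr.
  rewrite comm mulmxDr linearD/= -scalemxAr linearZ/= mulmxA mxtrace_mulC mulmxA.
  rewrite [X in _ * X]/mxtrace big_ord1 addrC => /eqP; rewrite addr_eq0 => /eqP ->.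
  by rewrite mulNr.
have xE : \col_l y l = - (beta t.+2 * eta) *: (S *m e^T).
  by rewrite scalemxAr trmx_delta -leading_eig// mulmxA mulVmx// mul1mx.
(* By [xE] the head of the eigenvector, transposed, is - beta eta e S, so its product with [c] is
   [eta] times the trace in [traceSD]. *)
have -> : eta * (\sum_(a < t.+1) y a * G a t.+1) = eta ^+ 2 * \tr (S *m D).
  have -> : \sum_(a < t.+1) y a * G a t.+1 = ((\col_(l < t.+1) y l)^T *m c) 0 0.
    by rewrite mxE; apply: eq_bigr => a _; rewrite !mxE.
  rewrite xE linearZ/= trmx_mul trmxK S_sym -scalemxAl mxE traceSD; ring.
(* [N] maps column i of [S] to a unit vector, so [N_gap] bounds that column. *)
have hS i : \sum_l (eta ^+ 2 * g * S l i) ^+ 2 <= 1.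
  under eq_bigr do rewrite exprMn; rewrite -mulr_sumr.
  have := N_gap (col i S); rewrite [in leRHS]colE mulmxA mulmxV// mul1mx.
  rewrite [leRHS](bigD1 i)//= [X in _ + X]big1 => [|l li]; last first.
    by rewrite mxE (negPf li) expr0n.
  by rewrite mxE !eqxx expr1n addr0; under eq_bigr do rewrite mxE.
(* Of two mirrored entries of [D] at most one is nonzero, and it is at most 2 delta in size; summing
   over mirrored pairs therefore halves the naive bound. *)
have hD : \sum_i \sum_l D l i ^+ 2 <= 2 * delta ^+ 2 * t.+1%:R ^+ 2.
  have Dle (i l : 'I_t.+1) : D l i ^+ 2 + D i l ^+ 2 <= 4 * delta ^+ 2.
    have dle (a b : 'I_t.+1) : (E a b - E b a) ^+ 2 <= 4 * delta ^+ 2.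
      have tlt (m : 'I_t.+1) : (m < n.+1)%N by exact: ltn_trans tn.
      have := E_le (tlt a) (tlt b); have := E_le (tlt b) (tlt a).
      rewrite !ler_norml => /andP[h1 h2] /andP[h3 h4]; nra.
    rewrite !mxE; case: ltngtP => _; rewrite ?expr0n ?addr0 ?add0r ?dle//.
    by rewrite mulr_ge0// sqr_ge0.
  have : \sum_(i < t.+1) \sum_(l < t.+1) (D l i ^+ 2 + D i l ^+ 2)
      <= \sum_(i < t.+1) \sum_(l < t.+1) 4 * delta ^+ 2.
    by apply: ler_sum => i _; apply: ler_sum => l _.
  rewrite !sumr_const !card_ord -mulrnA -[leRHS]mulr_natr natrM.
  under eq_bigr do rewrite big_split; rewrite big_split/= [X in _ + X]exchange_big/=.
  by move=> h; nra.
(* The trace is an entrywise inner product, so Cauchy-Schwarz separates [S], bounded by t + 1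
   through [hS], from [D]. *)
have -> : (eta ^+ 2 * \tr (S *m D)) ^+ 2 * g ^+ 2
    = (\sum_(p : 'I_t.+1 * 'I_t.+1) (eta ^+ 2 * g * S p.1 p.2) * D p.2 p.1) ^+ 2.
  rewrite -exprMn; congr (_ ^+ 2); rewrite mulrAC /mxtrace mulr_sumr.
  rewrite -(pair_bigA _ (fun i l => eta ^+ 2 * g * S i l * D l i))/=.
  by apply: eq_bigr => i _; rewrite mxE mulr_sumr; apply: eq_bigr => l _; rewrite mulrA.
apply: le_trans (sum_CauchySchwarz _ _ _) _.
rewrite -(pair_bigA _ (fun i l => (eta ^+ 2 * g * S i l) ^+ 2))/= exchange_big/=.
rewrite -(pair_bigA _ (fun i l => D l i ^+ 2))/=.
apply: le_trans (_ : t.+1%:R * (2 * delta ^+ 2 * t.+1%:R ^+ 2) <= _); last first.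
  by rewrite [t.+1%:R ^+ 3]exprS; lra.
apply: ler_pM => //; first by do 2![apply: sumr_ge0 => ? _]; exact: sqr_ge0.
  by do 2![apply: sumr_ge0 => ? _]; exact: sqr_ge0.
apply: le_trans (_ : \sum_(i < t.+1) 1 <= _); first exact: ler_sum.
by rewrite sumr_const card_ord.
Qed.

(** Column t costs at most sqrt 2 delta t^(3/2) / g by [gram_column_bound]. After summation over t,
    the separation hypothesis cancels every factor except 2/5. *)
Lemma ritz_overlap_bound :
  Num.sqrt 2 * (n.+1%:R ^+ 2 * Num.sqrt n.+1%:R) * delta <= g ->
  `|\sum_(t < n.+1) y t * \sum_(a < t) y a * G a t| <= 2 / 5.
Proof.
move=> sep; apply: le_trans (ler_norm_sum _ _ _) _.
have term (t : 'I_n.+1) : `|y t * \sum_(a < t) y a * G a t|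
    <= Num.sqrt 2 * delta / g * (t%:R * Num.sqrt t%:R).
  have r0 : 0 <= Num.sqrt 2 * delta / g * (t%:R * Num.sqrt t%:R).
    by rewrite !mulr_ge0 ?sqrtr_ge0 ?invr_ge0// ltW.
  case: t r0 => -[|t]/= tn r0; first by rewrite big_ord0 mulr0 normr0.
  rewrite -(@ler_pXn2r _ 2)// real_normK ?num_real//.
  rewrite !exprMn !sqr_sqrtr// mulrAC exprVn ler_pdivlMr ?exprn_gt0//.
  by rewrite -[y _ ^+ 2 * _]exprMn -exprSr; exact: gram_column_bound.
apply: le_trans (ler_sum _ (fun t _ => term t)) _.
rewrite -mulr_sumr; apply: le_trans (_ : Num.sqrt 2 * delta / g *
    (2 / 5 * (n.+1%:R ^+ 2 * Num.sqrt n.+1%:R)) <= _).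
  rewrite ler_wpM2l ?mulr_ge0 ?sqrtr_ge0 ?invr_ge0 ?(ltW g_gt0)//.
  exact: sum_nat_mul_sqrt_le.
have -> : Num.sqrt 2 * delta / g * (2 / 5 * (n.+1%:R ^+ 2 * Num.sqrt n.+1%:R))
  = 2 / 5 * (Num.sqrt 2 * (n.+1%:R ^+ 2 * Num.sqrt n.+1%:R) * delta / g) by ring.
by rewrite -[leRHS]mulr1 ler_wpM2l// ler_pdivrMr// mul1r.
Qed.

End RitzOverlap.

(** * Lanczos vectors, and the norm and residual of a Ritz vector *)

Lemma sum_symmetric_split (R : comPzRingType) (f : nat -> nat -> R) (m : nat) :
  (forall i l, f i l = f l i) ->
  \sum_(i < m) \sum_(l < m) f i l
    = \sum_(i < m) f i i + 2 * \sum_(t < m) \sum_(a < t) f a t.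
Proof.
move=> fC; elim: m => [|m ih]; first by rewrite !big_ord0 mulr0 addr0.
rewrite !big_ord_recr/=; under eq_bigr do rewrite big_ord_recr/=.
rewrite big_split/= ih; under [X in _ + (X + _)]eq_bigr do rewrite fC.
by ring.
Qed.

Section PerturbedLanczos.
Context {R : realType} {H : completeNormedModType R[i]}.
Context (dot : {dot H for (@Num.conj R[i])}) (dot_norm : norm_from_dot dot).
Local Notation rdot := (rdot dot).
Context (T : {linear H -> H}) (T_sym : forall x y, rdot (T x) y = rdot x (T y)).
Context (epsm : R) (epsm_gt0 : 0 < epsm) (zeta : H -> R) (n : nat).
Context (u w : nat -> H) (alpha beta : nat -> R).
Context (lanczos : perturbed_lanczos dot T epsm zeta n.+1 u w alpha beta).
Context (T_opnorm : 0 < opnorm T).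

(** Indices are shifted to start at 0, in agreement with matrix rows; [f] below holds the columns of
    the perturbation. *)
Let v i := u i.+1.

Let f i := T (v i) - w i.+1.

Let delta := max_zeta zeta u n.+1 * opnorm T `^ (3 / 2) * epsm.

Lemma lanczos_beta_gt0 i : (i < n.+1)%N -> 0 < beta i.+2.
Proof.
move=> ik; rewrite lt_def (lanczos_beta_neq0 lanczos)//.
by rewrite (lanczos_beta lanczos)// realnorm_ge0.
Qed.

Lemma lanczos_unit i : (i <= n.+1)%N -> realnorm (u i.+1) = 1.
Proof.
case: i => [|i] ik; first exact: lanczos_start lanczos.
have b0 := lanczos_beta_gt0 ik.
rewrite [u i.+2](lanczos_next lanczos)// realnormZ -(lanczos_beta lanczos)//.
by rewrite gtr0_norm ?invr_gt0// mulVf// gt_eqF.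
Qed.

(** [alpha] is exactly the coefficient of the real orthogonal projection onto the unit vector
    [u i.+1], so errors in [w] do not affect this. *)
Lemma lanczos_local_orthogonality i : (i < n.+1)%N -> rdot (u i.+1) (u i.+2) = 0.
Proof.
move=> ik; rewrite [u i.+2](lanczos_next lanczos)// rdotZr /lanczos_q rdotBr rdotZr.
rewrite (rdotE dot_norm) lanczos_unit ?(ltnW ik)// expr1n mulr1.
by rewrite (lanczos_alpha lanczos)// subrr mulr0.
Qed.

Lemma max_zeta_ge i : (i < n.+1)%N -> zeta (u i.+1) <= max_zeta zeta u n.+1.
Proof.
move=> ik; apply: (@le_bigmax_seq _ _ _ _ _ i.+1 predT (fun l => zeta (u l))) => //.
by rewrite mem_index_iota.
Qed.

Lemma max_zeta_gt0 : 0 < max_zeta zeta u n.+1.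
Proof.
by apply: lt_le_trans (max_zeta_ge (ltn0Sn n)); exact: lanczos_zeta_gt0 lanczos _ _.
Qed.

Let delta_gt0 : 0 < delta.
Proof. by rewrite !mulr_gt0 ?max_zeta_gt0 ?powR_gt0. Qed.

Lemma lanczos_recurrence i : (i < n.+1)%N ->
  T (v i) = (beta i.+2)%:C *: v i.+1 + (alpha i.+1)%:C *: v i
    + (if (0 < i)%N then (beta i.+1)%:C *: v i.-1 else 0) + f i.
Proof.
move=> ik; have b0 := lanczos_beta_gt0 ik.
have -> : (beta i.+2)%:C *: v i.+1 = lanczos_q u w alpha beta i.+1.
  rewrite /v [u i.+2](lanczos_next lanczos)// scalerA -rmorphM mulfV ?gt_eqF//.
  by rewrite rmorph1 scale1r.
rewrite /lanczos_q subrK /lanczos_p /f eqSS.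
by case: i ik {b0} => [|i] ik /=; rewrite ?addr0 ?subrK addrC subrK.
Qed.

Lemma lanczos_error_le i : (i < n.+1)%N -> realnorm (f i) <= delta.
Proof.
move=> ik; apply: le_trans (lanczos_error lanczos _) _ => //.
rewrite lanczos_unit ?(ltnW ik)// mulr1 /delta !ler_pM2r ?powR_gt0//.
exact: max_zeta_ge.
Qed.

Context (Y : 'M[R]_n.+1) (mu : 'I_n.+1 -> R).
Context (Y_eig : tridiag alpha beta n.+1 *m Y = Y *m diag_mx (\row_i mu i)).
Context (Y_orth : Y^T *m Y = 1%:M).
Context (j : 'I_n.+1).

Definition ritz_vector : H := \sum_(i < n.+1) (Y i j)%:C *: u i.+1.

(** The squared norm is at least 1 - 4/5 = 1/5, which exceeds (2/5)^2 = 4/25; the inverse of 2/5 is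
    the factor 5/2 of the final bound. *)
Lemma ritz_vector_norm :
  (forall i, i != j -> Num.sqrt 2 * (n.+1%:R ^+ 2 * Num.sqrt n.+1%:R) * delta
     <= `|mu j - mu i|) ->
  2 / 5 < realnorm ritz_vector.
Proof.
move=> gap; set g := Num.sqrt 2 * _ * delta in gap.
have g0 : 0 < g.
  by rewrite mulr_gt0// !mulr_gt0 ?exprn_gt0 ?sqrtr_gt0 ?ltr0n.
have G_diag i : (i < n.+1)%N -> rdot (v i) (v i) = 1.
  by move=> ik; rewrite (rdotE dot_norm) lanczos_unit ?(ltnW ik)// expr1n.
have G_next i : (i.+1 < n.+1)%N -> rdot (v i) (v i.+1) = 0.
  by move=> ik; apply: lanczos_local_orthogonality; exact: ltnW.
(* Symmetry of [T] on two Lanczos vectors, with both images expanded by the recurrence. *)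
have G_rel i l : (i < n.+1)%N -> (l < n.+1)%N ->
    beta l.+2 * rdot (v i) (v l.+1) + alpha l.+1 * rdot (v i) (v l)
      + (if (0 < l)%N then beta l.+1 * rdot (v i) (v l.-1) else 0) + rdot (v i) (f l)
    = beta i.+2 * rdot (v i.+1) (v l) + alpha i.+1 * rdot (v i) (v l)
      + (if (0 < i)%N then beta i.+1 * rdot (v i.-1) (v l) else 0) + rdot (v l) (f i).
  move=> ik lk; have := T_sym (v i) (v l).
  move: (lanczos_recurrence ik) (lanczos_recurrence lk).
  move: (f i) (f l) => fi fl -> ->.
  rewrite !(rdotDl, rdotDr, rdotZl, rdotZr) (rdotC _ fi) => /esym.
  by case: posnP => _; case: posnP => _;
    rewrite ?(rdotC _ (v i) 0) ?rdot0l ?(rdotZl, rdotZr).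
have E_le i l : (i < n.+1)%N -> (l < n.+1)%N -> `|rdot (v i) (f l)| <= delta.
  move=> ik lk; apply: le_trans (rdot_CauchySchwarz dot_norm _ _) _.
  by rewrite lanczos_unit ?(ltnW ik)// mul1r lanczos_error_le.
have := ritz_overlap_bound G_diag G_next G_rel (ltW delta_gt0) E_le Y_eig Y_orth
  g0 gap (lexx g).
set W := \sum_(t < _) _ => W_le.
have zE : realnorm ritz_vector ^+ 2 = 1 + 2 * W.
  pose y i := Y (inord i) j.
  transitivity (\sum_(i < n.+1) \sum_(l < n.+1) y i * y l * rdot (v i) (v l)).
    rewrite -(rdotE dot_norm) {1}/ritz_vector rdot_suml; apply: eq_bigr => i _.
    rewrite rdotC /ritz_vector rdot_suml; apply: eq_bigr => l _.
    by rewrite rdotZl rdotZr /y !inord_val mulrA [Y l j * _]mulrC (rdotC _ (u l.+1)).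
  rewrite (sum_symmetric_split _ (f := fun i l => y i * y l * rdot (v i) (v l))).
    congr (_ + 2 * _).
      rewrite -(eigenvector_sqr_sum Y_orth j); apply: eq_bigr => i _.
      by rewrite G_diag// mulr1 /y inord_val expr2.
    apply: eq_bigr => t _; rewrite mulr_sumr; apply: eq_bigr => a _.
    by rewrite /y mulrA [Y (inord t) j * _]mulrC.
  by move=> i l; rewrite (mulrC (y i)) (rdotC _ (v i)).
move: W_le; rewrite ler_norml => /andP[W_ge _].
rewrite -(@ltr_pXn2r _ 2)// ?nnegrE ?realnorm_ge0// zE; lra.
Qed.

(** Applying the matrix form of the recurrence to the eigenvector cancels the tridiagonal part. What
    remains is the boundary vector of row k and the errors weighted by a unit vector, whose entries
    sum in absolute value to at most sqrt k. *)
Lemma ritz_residual_norm :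
  realnorm (T ritz_vector - (mu j)%:C *: ritz_vector)
    <= beta n.+2 * `|Y ord_max j| + Num.sqrt n.+1%:R * delta.
Proof.
have resE : T ritz_vector - (mu j)%:C *: ritz_vector
    = (beta n.+2 * Y ord_max j)%:C *: v n.+1 + \sum_(i < n.+1) (Y i j)%:C *: f i.
  have rowE (i : 'I_n.+1) : T (v i)
      = \sum_(l < n.+1) (tridiag alpha beta n.+1 i l)%:C *: v l
        + ((if i == ord_max then (beta n.+2)%:C *: v n.+1 else 0) + f i).
    rewrite (lanczos_recurrence (ltn_ord i)).
    rewrite (@tridiag_row_sum _ _ (fun a x => a%:C *: x)) => [|x]; last by rewrite scale0r.
    have -> : (i == ord_max) = (i.+1 == n.+1) by [].
    case: eqVneq => [[e]|ne].
      rewrite e ltnn addr0 [RHS]addrA; congr (_ + _).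
      by rewrite [RHS]addrC addrA.
    have -> : (i.+1 < n.+1)%N by rewrite ltn_neqAle ne ltn_ord.
    by rewrite add0r (addrC (_ *: v i.+1)).
  have rowT (l : 'I_n.+1) :
      \sum_i tridiag alpha beta n.+1 i l * Y i j = mu j * Y l j.
    have := congr1 (fun M : 'cV[R]_n.+1 => M l 0) (mulmx_eigencol Y_eig j).
    rewrite !mxE => <-; apply: eq_bigr => i _.
    by rewrite [col j Y i 0]mxE -[in LHS]trmx_tridiag mxE.
  rewrite /ritz_vector linear_sum/=.
  under eq_bigr do rewrite linearZ/= rowE scalerDr scalerDr.
  rewrite big_split big_split/=.
  have -> : \sum_(i < n.+1) (Y i j)%:C *: (\sum_(l < n.+1)
      (tridiag alpha beta n.+1 i l)%:C *: v l)
    = (mu j)%:C *: \sum_(i < n.+1) (Y i j)%:C *: v i.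
    under eq_bigr do rewrite scaler_sumr; rewrite exchange_big scaler_sumr/=.
    apply: eq_bigr => l _; rewrite scalerA -rmorphM -rowT rmorph_sum scaler_suml.
    by apply: eq_bigr => i _; rewrite scalerA -rmorphM mulrC.
  have -> : \sum_(i < n.+1) (Y i j)%:C *:
      (if i == ord_max then (beta n.+2)%:C *: v n.+1 else 0)
    = (beta n.+2 * Y ord_max j)%:C *: v n.+1.
    rewrite (bigD1 ord_max)//= big1 => [|i /negPf ->]; last by rewrite scaler0.
    by rewrite eqxx addr0 scalerA -rmorphM mulrC.
  by rewrite addrAC subrr add0r.
rewrite resE; apply: le_trans (realnormD _ _) _.
rewrite realnormZ normrM (gtr0_norm (lanczos_beta_gt0 (ltnSn n))).
rewrite lanczos_unit// mulr1 lerD2l; apply: le_trans (realnorm_sum _ _) _.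
(* The factor 1 prepares Cauchy-Schwarz against the constant vector. *)
apply: le_trans (_ : (\sum_(i < n.+1) `|Y i j| * 1) * delta <= _).
  rewrite mulr_suml; apply: ler_sum => i _; rewrite realnormZ mulr1.
  by rewrite ler_wpM2l// lanczos_error_le.
rewrite ler_pM2r// -(@ler_pXn2r _ 2) ?nnegrE ?sqrtr_ge0 ?sumr_ge0//.
  apply: le_trans (sum_CauchySchwarz _ _ _) _.
  rewrite sqr_sqrtr// expr1n sumr_const card_ord.
  under eq_bigr do rewrite real_normK ?num_real//.
  by rewrite eigenvector_sqr_sum// mul1r.
Qed.

End PerturbedLanczos.

(** * Resolvent, adjoint and operator norm; the final bound *)

Section Resolvent.
Context {R : realType} {H : completeNormedModType R[i]}.
Context (dot : {dot H for (@Num.conj R[i])}) (dot_norm : norm_from_dot dot).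

(** |B x|^2 = <A (B x), x> <= K |B x| |x|, and |B x| can be divided out. *)
Lemma adjoint_realnorm_bound (A B : {linear H -> H}) (K : R) :
  is_adjoint dot A B -> 0 <= K ->
  (forall x, realnorm (A x) <= K * realnorm x) ->
  forall x, realnorm (B x) <= K * realnorm x.
Proof.
move=> adj K0 AK x; have [->|Bx0] := eqVneq (B x) 0.
  by rewrite realnorm0 mulr_ge0 ?realnorm_ge0.
have {}Bx0 : 0 < realnorm (B x) by rewrite lt_def realnorm_eq0 Bx0 realnorm_ge0.
rewrite -(ler_pM2l Bx0) -expr2 -(rdotE dot_norm) /rdot -adj mulrCA mulrA -/(rdot _ _ _).
apply: le_trans (ler_norm _) _; apply: le_trans (rdot_CauchySchwarz dot_norm _ _) _.
by rewrite ler_wpM2r ?realnorm_ge0.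
Qed.

Lemma adjoint_comp_rdot (A B : {linear H -> H}) (x y : H) :
  is_adjoint dot A B -> rdot dot (B (A x)) y = rdot dot (A x) (A y).
Proof. by move=> adj; rewrite rdotC /rdot -adj -/(rdot _ _ _) rdotC. Qed.

Lemma resolvent_eq0 (D : set H) (L : H -> H) (z : R[i]) (B : {linear H -> H}) (x : H) :
  is_resolvent D L z B -> B x = 0 -> x = 0.
Proof.
(* [x] is recovered from [B x] alone; comparison with the argument 0 gives injectivity without
   evaluating [L]. *)
case=> _ BR _ Bx; have [_ <-] := BR x; have [_ <-] := BR 0.
by rewrite Bx linear0.
Qed.

Lemma opnorm_ge (A : {linear H -> H}) (K : R) (x : H) :
  (forall y, realnorm (A y) <= K * realnorm y) -> 0 <= K -> realnorm x <= 1 ->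
  realnorm (A x) <= opnorm A.
Proof.
move=> AK K0 x1; apply: ub_le_sup; last by exists x.
exists K => _ [y y1 <-]; apply: le_trans (AK y) _.
by rewrite -[leRHS]mulr1 ler_wpM2l.
Qed.

End Resolvent.

Lemma powR_5half (R : realType) (x : R) : 0 < x ->
  x `^ (5 / 2) = x ^+ 2 * Num.sqrt x.
Proof.
move=> x0; have -> : 5 / 2 = 2%:R + 2^-1 :> R by field.
by rewrite powRD ?gt_eqF ?implybT// powR_mulrn ?powR12_sqrt// ltW.
Qed.

(* The number of steps is k = n.+1, so that the last row of Y is ord_max. *)
Theorem theorem4p6 (R : realType) (H : completeNormedModType R[i])
    (dot : {dot H for (@Num.conj R[i])}) (dot_norm : norm_from_dot dot)
    (H_sep : separable_space H)
    (D : set H) (L : H -> H) (L_closed : closed_operator D L)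
    (z : R[i]) (Rz : {linear H -> H}) (Rz_res : is_resolvent D L z Rz)
    (Rzs : {linear H -> H}) (Rzs_adj : is_adjoint dot Rz Rzs)
    (T : H -> H) (T_def : T = Rzs \o Rz)
    (epsm : R) (epsm_gt0 : 0 < epsm) (zeta : H -> R) (n : nat)
    (u w : nat -> H) (alpha beta : nat -> R)
    (lanczos : perturbed_lanczos dot T epsm zeta n.+1 u w alpha beta)
    (Y : 'M[R]_n.+1) (mu : 'I_n.+1 -> R)
    (Y_eig : tridiag alpha beta n.+1 *m Y = Y *m diag_mx (\row_i mu i))
    (Y_orth : Y^T *m Y = 1%:M)
    (mu_decr : forall i i' : 'I_n.+1, (i < i')%N -> mu i' < mu i)
    (j : 'I_n.+1)
    (mu_sep : forall i : 'I_n.+1, i != j ->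
       Num.sqrt 2 * n.+1%:R `^ (5 / 2) * max_zeta zeta u n.+1
         * opnorm T `^ (3 / 2) * epsm <= `|mu j - mu i|) :
  (dist_to_set (mu j)%:C (spectrum T)
     < (5 / 2 * (beta n.+2 * `|Y ord_max j|
          + Num.sqrt n.+1%:R * max_zeta zeta u n.+1
              * opnorm T `^ (3 / 2) * epsm))%:E)%E.
Proof.
have T_lin : T = (Rzs \o Rz : {linear H -> H}) by rewrite T_def.
move: lanczos mu_sep; rewrite {}T_lin.
set A : {linear H -> H} := Rzs \o Rz => A_lanczos A_sep {T_def T}.
have [K K0 RzK] : exists2 K : R, 0 < K & forall x, realnorm (Rz x) <= K * realnorm x.
  by apply: linear_realnorm_bound; case: Rz_res.
have RzsK := adjoint_realnorm_bound dot_norm Rzs_adj (ltW K0) RzK.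
have A_bound x : realnorm (A x) <= K * K * realnorm x.
  by rewrite -mulrA; apply: le_trans (RzsK _) _; rewrite ler_pM2l.
have A_sym x y : rdot dot (A x) y = rdot dot x (A y).
  by rewrite (adjoint_comp_rdot _ _ Rzs_adj) rdotC [RHS]rdotC (adjoint_comp_rdot _ _ Rzs_adj).
(* This makes the error level, hence the gap, positive. It holds because <A u_1, u_1> = |Rz u_1|^2
   and the resolvent is injective. *)
have A_pos : 0 < opnorm A.
  have u1 := lanczos_start A_lanczos.
  have u1_le : realnorm (u 1%N) <= 1 by rewrite u1.
  apply: lt_le_trans (opnorm_ge A_bound _ u1_le); last by rewrite mulr_ge0// ltW.
  rewrite lt_def realnorm_ge0 andbT realnorm_eq0; apply/eqP => Au0.
  have := adjoint_comp_rdot (u 1%N) (u 1%N) Rzs_adj.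
  have -> : Rzs (Rz (u 1%N)) = A (u 1%N) by [].
  rewrite Au0 rdot0l (rdotE dot_norm) => /esym/eqP.
  rewrite sqrf_eq0 realnorm_eq0 => /eqP /(resolvent_eq0 Rz_res) u0.
  by move: u1; rewrite u0 realnorm0 => /esym/eqP; rewrite oner_eq0.
set delta := max_zeta zeta u n.+1 * opnorm A `^ (3 / 2) * epsm.
have gap i : i != j ->
    Num.sqrt 2 * (n.+1%:R ^+ 2 * Num.sqrt n.+1%:R) * delta <= `|mu j - mu i|.
  by move=> /A_sep; rewrite powR_5half ?ltr0n// /delta !mulrA.
have x_gt := ritz_vector_norm dot_norm A_sym epsm_gt0 A_lanczos A_pos Y_eig Y_orth gap.
have res := ritz_residual_norm epsm_gt0 A_lanczos A_pos Y_eig Y_orth j.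
set x := ritz_vector u Y j in x_gt res; rewrite -/delta in res.
have x_pos : 0 < realnorm x by apply: lt_trans x_gt; rewrite divr_gt0.
have x0 : x != 0 by rewrite -realnorm_eq0 gt_eqF.
apply: le_lt_trans (dist_spectrum_le dot_norm A_bound A_sym (mu j) x0) _.
rewrite lte_fin ltr_pdivrMr// -!(mulrA (Num.sqrt n.+1%:R)) -/delta.
(* The residual is at most [rho] and the norm of [x] exceeds 2/5, so positivity of [rho] yields the
   strict inequality. *)
set rho := beta n.+2 * _ + _ in res *; have rho0 : 0 < rho.
  rewrite ltr_wpDl ?mulr_ge0//; first by rewrite ltW// (lanczos_beta_gt0 A_lanczos).
  by rewrite !mulr_gt0 ?sqrtr_gt0 ?ltr0n ?powR_gt0// (max_zeta_gt0 A_lanczos).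
by apply: le_lt_trans res _; nra.
Qed.
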